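(* Let $d=3$ and $\gamma>2$. Let $\mathbf{P}(t)=(P_0(t),P_1(t),P_2(t),P_3(t))$ be the relativistic Ornstein–Uhlenbeck momentum process with mass $m=1$, i.e. $P_0(t)=\cosh(S_t)$, $(P_1(t),P_2(t),P_3(t))=\sinh(S_t)\,\Theta_{\tau(t)}$, where $S$ is the $(0,+\infty)$-valued diffusion solving $$dS_t=\Bigl(\coth(S_t)-\frac{\gamma}{2}\tanh(S_t)\Bigr)dt+dW_t,$$ $W$ is a standard one-dimensional Wiener process, $\Theta$ is a Wiener process on the unit sphere $S^2\subset\mathbb{R}^3$ independent of $S$, and $\tau(t)=\int_0^t\sinh(S_r)^{-2}\,dr$. Then the cartesian components $P_i$, $i=1,2,3$, have marginal invariant densities $\varphi_{P_i}$ with respect to Lebesgue measure on $(\mathbb{R},\mathcal{B}(\mathbb{R}))$ given by $$\varphi_{P_i}(p)=\frac{1}{n_\gamma}\,(1+p^2)^{-(\gamma-1)/2},\qquad i=1,2,3,\ p\in\mathbb{R},$$ where $n_\gamma=\int_{\mathbb{R}}(1+p^2)^{-(\gamma-1)/2}\,dp$ is the normalization constant.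
   Context: A Wiener process on $S^2$ is a path-continuous Markov process with generator $\frac12$ times the standard Laplace–Beltrami operator of $S^2$. The process $(S_t,\Theta_{\tau(t)})$ on $(0,\infty)\times S^2$ has an invariant probability measure proportional to $\cosh(s)^{-\gamma}\sinh(s)^2\,ds\,d\sigma_{S^2}$, with $d\sigma_{S^2}$ the surface measure of $S^2$; the marginal invariant density of a component is the density of its law when $(S_t,\Theta_{\tau(t)})$ is distributed according to this invariant probability measure. *)

(* Defs.v *)
From HB Require Import structures.
From mathcomp Require Import all_boot all_order all_algebra.
From mathcomp Require Import all_classical all_reals all_analysis measurable_realfun.
Set Implicit Arguments.
Unset Strict Implicit.
Unset Printing Implicit Defensive.
Import Order.TTheory GRing.Theory Num.Theory.
Import numFieldNormedType.Exports.
Local Open Scope classical_set_scope.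
Local Open Scope ring_scope.

Section hyperbolic.
Context {R : realType}.
Implicit Type s : R.
Definition sinh s := (expR s - expR (- s)) / 2.
Definition cosh s := (expR s + expR (- s)) / 2.
Definition tanh s := sinh s / cosh s.
Definition coth s := cosh s / sinh s.
End hyperbolic.

(* R^3 is the iterated product R * R * R, whose library topology and
   sigma-algebra are the usual ones. The library norm on it is the sup norm,
   hence the separate Euclidean norm. *)
Notation vec3 R := (R * R * R)%type.

Section sphere.
Context {R : realType}.
Implicit Types x y : vec3 R.

Definition component (i : 'I_3) x : R := nth 0 [:: x.1.1; x.1.2; x.2] i.

Definition basis_vector (i : 'I_3) : vec3 R :=
  ((i == 0%N :> nat)%:R, (i == 1%N :> nat)%:R, (i == 2%N :> nat)%:R).

Definition enorm x : R := Num.sqrt (\sum_(i < 3) component i x ^+ 2).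

Definition sphere : set (vec3 R) := [set x | enorm x = 1].

Definition normalise x : vec3 R :=
  (x.1.1 / enorm x, x.1.2 / enorm x, x.2 / enorm x).

(* Surface measure of the unit sphere of R^n: n times the Lebesgue measure of
   the cone {r y | 0 < r <= 1, y \in A}, here with n = 3. The library has no
   Hausdorff measure. *)
Definition surface_measure (A : set (vec3 R)) : \bar R :=
  (3%:E * ((lebesgue_measure \x lebesgue_measure) \x lebesgue_measure)
    [set x | (0 < enorm x <= 1)%R /\ (A `&` sphere) (normalise x)])%E.

Definition partial (i : 'I_3) (F : vec3 R -> R) : vec3 R -> R :=
  'D_(basis_vector i) F.

Definition homogeneous_ext (f : vec3 R -> R) : vec3 R -> R := f \o normalise.

(* C^2 functions on the sphere. Only the values of f on the sphere matter. *)
Definition C2_sphere (f : vec3 R -> R) : Prop :=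
  let F := homogeneous_ext f in
  forall (i j : 'I_3) x, x != 0 ->
    [/\ derivable F x (basis_vector i), derivable (partial i F) x (basis_vector j),
        {for x, continuous (partial i F)} &
        {for x, continuous (partial j (partial i F))}].

(* On the unit sphere, the Laplace-Beltrami operator applied to f is the
   Euclidean Laplacian of the extension of f that is homogeneous of degree 0. *)
Definition laplace_beltrami (f : vec3 R -> R) x : R :=
  \sum_(i < 3) partial i (partial i (homogeneous_ext f)) x.

End sphere.

Section surface_measure_theory.
Context {R : realType}.
Implicit Types A : set (vec3 R).

Lemma measurable_inv_real : measurable_fun setT (@GRing.inv R).
Proof.
have -> : [set: R] = ([set 0] `|` ~` [set 0])%classic by rewrite setUv.
apply/measurable_funU => //; first exact: measurableC.
split; first exact: measurable_fun_set1.
apply: subspace_continuous_measurable_fun; first exact: measurableC.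
rewrite continuous_open_subspace; last exact/closed_openC/accessible_closed_set1/hausdorff_accessible/Rhausdorff.
by move=> x; rewrite inE => /eqP x0; exact: inv_continuous.
Qed.

Lemma measurable_coord i : measurable_fun setT (@component R i).
Proof.
have m1 : measurable_fun setT (fun x : vec3 R => x.1) by exact: measurable_fst.
case: i => -[|[|[|//]]] /= ?; rewrite /component /=.
- exact: measurableT_comp.
- exact: (measurableT_comp measurable_snd).
- exact: measurable_snd.
Qed.

Lemma measurable_enorm : measurable_fun setT (@enorm R).
Proof.
apply: (measurableT_comp (f := @Num.sqrt R)).
  by apply: continuous_measurable_fun; exact: sqrt_continuous.
apply: measurable_sum => i; apply: measurable_funX; exact: measurable_coord.
Qed.

Lemma measurable_sphere : measurable (@sphere R).
Proof.
rewrite [sphere](_ : _ = setT `&` enorm @^-1` [set 1]); last by rewrite setTI.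
exact: measurable_enorm.
Qed.

Lemma measurable_normalise : measurable_fun setT (@normalise R).
Proof.
have mV : measurable_fun setT (fun x : vec3 R => (enorm x)^-1).
  exact: (measurableT_comp measurable_inv_real measurable_enorm).
have m1 : measurable_fun setT (fun x : vec3 R => x.1.1).
  exact: (measurable_coord (Ordinal (isT : 0 < 3)%N)).
apply: measurable_fun_pair; last first.
  by apply: measurable_funM => //; exact: measurable_snd.
apply: measurable_fun_pair; apply: measurable_funM => //.
apply: (measurableT_comp measurable_snd); exact: measurable_fst.
Qed.

Let cone A := [set x | (0 < enorm x <= 1)%R /\ (A `&` sphere) (normalise x)].

Let measurable_cone A : measurable A -> measurable (cone A).
Proof.
move=> mA.
rewrite (_ : cone A = (setT `&` enorm @^-1` `]0, 1]) `&`
  (setT `&` normalise @^-1` (A `&` sphere))).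
  apply: measurableI.
    exact: (@measurable_enorm measurableT _ (measurable_itv `]0%R, 1%R])). 
  apply: (@measurable_normalise measurableT (A `&` sphere)).
  by apply: measurableI => //; exact: measurable_sphere.
by rewrite !setTI; apply/seteqP; split => x /=; rewrite in_itv.
Qed.

Let surface_measure0 : surface_measure set0 = 0 :> \bar R.
Proof.
rewrite /surface_measure (_ : [set x | _] = set0) ?measure0 ?mule0//.
by apply/seteqP; split => x //= [_ []].
Qed.

Let surface_measure_ge0 A : (0 <= surface_measure A)%E.
Proof. by rewrite mule_ge0. Qed.

Let surface_measure_sigma_additive : semi_sigma_additive (@surface_measure R).
Proof.
move=> A mA tA mUA; rewrite /surface_measure -/(cone _).
rewrite [X in X @ _ --> _](_ : _ = (fun n => 3%:E *
  \sum_(0 <= i < n) ((lebesgue_measure \x lebesgue_measure) \x lebesgue_measure)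
    (cone (A i)))%E); last first.
  by apply/funext => n; rewrite ge0_sume_distrr.
apply: cvgeZl => //.
rewrite (_ : cone _ = \bigcup_n cone (A n)); last first.
  apply/seteqP; split => x /= [].
    by move=> ? [[n _ An] ?]; exists n.
  by move=> n _ [? [? ?]]; split=> //; split=> //; exists n.
apply: measure_sigma_additive => [n|]; first exact: measurable_cone.
apply/trivIsetP => i j _ _ ij; apply/seteqP; split => x //= -[[_ [Ai _]] [_ [Aj _]]].
have := (trivIsetP.1 tA) i j Logic.I Logic.I ij.
by move/seteqP => [H _]; apply: (H (normalise x)); split; [exact: Ai|exact: Aj].
Qed.

HB.instance Definition _ := isMeasure.Build _ _ _ (@surface_measure R)
  surface_measure0 surface_measure_ge0 surface_measure_sigma_additive.

Let surface_measure_fin : fin_num_fun (@surface_measure R).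
Proof.
move=> A mA; rewrite /surface_measure -/(cone _) fin_numM//.
rewrite ge0_fin_numE//.
apply: (@le_lt_trans _ _
  (((lebesgue_measure \x lebesgue_measure) \x lebesgue_measure)
    ((`[(-1)%R, 1%R] `*` `[(-1)%R, 1%R]) `*` `[(-1)%R, 1%R] : set (vec3 R)))%E).
  apply: le_measure; rewrite ?inE.
  - exact: measurable_cone.
  - by apply: measurableX => //; exact: measurableX.
  - move=> x [/andP[_ x1] _].
    have cx i : component i x \in `[-1, 1].
      rewrite in_itv/= -ler_norml -sqrtr_sqr (le_trans _ x1)// ler_wsqrtr//.
      rewrite (bigD1 i)//= lerDl sumr_ge0// => j _; exact: sqr_ge0.
    split; [split|].
    + by have := cx ord0.
    + by have := cx (lift ord0 ord0).
    + by have := cx ord_max.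
have mI : measurable (`[(-1)%R, 1%R] : set R) by exact: measurable_itv.
have II := @product_measure1E _ _ _ _ R lebesgue_measure lebesgue_measure _ _ mI mI.
have III := @product_measure1E _ _ _ _ R (lebesgue_measure \x lebesgue_measure)%E
  lebesgue_measure _ _ (measurableX mI mI) mI.
rewrite [X in (X < _)%E]III [X in (X * _)%E]II.
have LI : lebesgue_measure (`[(-1)%R, 1%R] : set R) \is a fin_num.
  by rewrite lebesgue_measure_itv/=; case: ifP.
by rewrite ltey_eq; apply/orP; left; rewrite !fin_numM.
Qed.

HB.instance Definition _ := Measure_isFinite.Build _ _ _ (@surface_measure R)
  surface_measure_fin.

End surface_measure_theory.

Section processes.
Context {R : realType} {d : measure_display} {T : measurableType d}.
Implicit Type P : probability T R.

Definition has_law {d'} {U : measurableType d'} P (X : T -> U)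
    (mu : set U -> \bar R) : Prop :=
  measurable_fun setT X /\ forall B, measurable B -> pushforward P X B = mu B.

Definition has_density P (X : T -> R) (f : R -> R) : Prop :=
  [/\ measurable_fun setT f, (forall x, 0 <= f x) &
      has_law P X (fun B => \int[lebesgue_measure]_(x in B) (f x)%:E)%E].

Definition sigma_process {d'} {U : measurableType d'} (I : set R)
    (X : R -> T -> U) : set (set T) :=
  <<s \bigcup_(r in I) preimage_set_system setT (X r) measurable >>.

Definition independent_processes {d1 d2} {U1 : measurableType d1}
    {U2 : measurableType d2} P (X : R -> T -> U1) (Y : R -> T -> U2) : Prop :=
  forall A B, sigma_process `[0, +oo[ X A -> sigma_process `[0, +oo[ Y B ->
    P (A `&` B) = (P A * P B)%E.

Definition filtration (F : R -> set (set T)) : Prop :=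
  [/\ forall t, 0 <= t -> sigma_algebra setT (F t),
      forall t, 0 <= t -> F t `<=` measurable &
      forall s t, 0 <= s -> s <= t -> F s `<=` F t].

Definition adapted (F : R -> set (set T)) (X : R -> T -> R) : Prop :=
  forall t, 0 <= t -> preimage_set_system setT (X t) measurable `<=` F t.

Definition continuous_paths {U : topologicalType} (X : R -> T -> U) : Prop :=
  forall w, {within `[0, +oo[, continuous (fun t => X t w)}.

(* The second parameter of normal_prob is the standard deviation. *)
Definition wiener P (F : R -> set (set T)) (W : R -> T -> R) : Prop :=
  [/\ {ae P, forall w, W 0 w = 0},
      continuous_paths W,
      adapted F W,
      forall s t : R, 0 <= s -> s < t ->
        has_law P (fun w => W t w - W s w) (normal_prob 0 (Num.sqrt (t - s))) &
      forall (s t : R) A B, 0 <= s -> s < t -> F s A -> measurable B ->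
        P (A `&` (fun w => W t w - W s w) @^-1` B) =
        (P A * P ((fun w => W t w - W s w)%R @^-1` B))%E].

(* The noise is additive, so the stochastic differential equation is an
   equation between paths and involves no stochastic integral. *)
Definition radial_diffusion P (F : R -> set (set T)) (gamma : R)
    (W S : R -> T -> R) : Prop :=
  [/\ forall t w, 0 <= t -> 0 < S t w,
      continuous_paths S,
      adapted F S &
      {ae P, forall w, forall t, 0 <= t ->
        S t w = S 0 w
          + \int[lebesgue_measure]_(r in `[0, t])
              (coth (S r w) - gamma / 2 * tanh (S r w))
          + W t w}].

Definition semigroup_op (K : R -> R.-pker (vec3 R) ~> (vec3 R)) (t : R)
    (f : vec3 R -> R) (x : vec3 R) : R :=
  \int[K t x]_(y in sphere) f y.

(* Transition function of a Feller process on the sphere. The values of K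
   off the sphere are irrelevant. *)
Definition feller_sphere (K : R -> R.-pker (vec3 R) ~> (vec3 R)) : Prop :=
  [/\ forall t x, 0 <= t -> sphere x -> K t x sphere = 1%E,
      forall x B, sphere x -> measurable B -> K 0 x B = \d_x B,
      forall s t x B, 0 <= s -> 0 <= t -> sphere x -> measurable B ->
        K (s + t) x B = (\int[K s x]_(y in sphere) K t y B)%E &
      forall t f, 0 <= t -> {within sphere, continuous f} ->
        {within sphere, continuous (semigroup_op K t f)}].

(* The function f is in the domain of the generator of K and is mapped to g. *)
Definition generator (K : R -> R.-pker (vec3 R) ~> (vec3 R))
    (f g : vec3 R -> R) : Prop :=
  {uniform sphere,
    (fun t x => t^-1 * (semigroup_op K t f x - f x)) @ 0^'+ --> g}.

Definition markov_sphere P (K : R -> R.-pker (vec3 R) ~> (vec3 R))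
    (Theta : R -> T -> vec3 R) : Prop :=
  forall s t A B, 0 <= s -> 0 <= t ->
    sigma_process `[0, s] Theta A -> measurable B ->
    P (A `&` Theta (s + t) @^-1` B) = (\int[P]_(w in A) K t (Theta s w) B)%E.

Definition wiener_sphere P (Theta : R -> T -> vec3 R) : Prop :=
  [/\ forall t, 0 <= t -> measurable_fun setT (Theta t),
      forall t w, 0 <= t -> sphere (Theta t w),
      continuous_paths Theta &
      exists K : R -> R.-pker (vec3 R) ~> (vec3 R),
        [/\ feller_sphere K, markov_sphere P K Theta &
            forall f, C2_sphere f ->
              generator K f (fun x => 2^-1 * laplace_beltrami f x)]].

Definition clock (S : R -> T -> R) (t : R) (w : T) : R :=
  \int[lebesgue_measure]_(r in `[0, t]) (sinh (S r w)) ^- 2.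

(* Unit mass; row vector indexed by 'I_4, with the energy P_0 at index 0. *)
Definition momentum (S : R -> T -> R) (Theta : R -> T -> vec3 R) (t : R)
    (w : T) : 'rV[R]_4 :=
  \row_k (if unlift ord0 k is Some i
          then sinh (S t w) * component i (Theta (clock S t w) w)
          else cosh (S t w)).

End processes.

Section invariant.
Context {R : realType}.

Definition invariant_weight (gamma : R) (B : set (R * vec3 R)) : \bar R :=
  (\int[lebesgue_measure \x surface_measure]_(z in B `&` (`]0%R, +oo[ `*` sphere))
    (cosh z.1 `^ (- gamma) * sinh z.1 ^+ 2)%:E)%E.

Definition invariant_law (gamma : R) (B : set (R * vec3 R)) : \bar R :=
  ((fine (invariant_weight gamma setT))^-1%:E * invariant_weight gamma B)%E.

Definition n_gamma (gamma : R) : R :=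
  \int[lebesgue_measure]_p (1 + p ^+ 2) `^ (- (gamma - 1) / 2).

End invariant.

(* Main.v *)
(* The weight cosh(s)^(-gamma) sinh(s)^2 is cosh(s)^(-gamma-1) times the radial
   density sinh(s)^2 cosh(s) of Lebesgue measure on R^3 in the polar coordinates
   x = sinh(s) theta. Under the invariant law the momentum therefore has a
   density proportional to (1 + |x|^2)^(-(gamma+1)/2) on R^3. Integrating out two
   coordinates and rescaling them by sqrt(1 + p^2) leaves a constant times
   (1 + p^2)^(1-(gamma+1)/2), and the exponent is -(gamma-1)/2. All the constants
   are finite and nonzero because the law is a probability. *)
From HB Require Import structures.
Require Import Defs.
From mathcomp Require Import all_boot all_order all_algebra.
From mathcomp Require Import all_classical all_reals all_analysis.
From mathcomp Require Import measurable_realfun ring.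
Import Order.TTheory GRing.Theory Num.Theory.
Import numFieldNormedType.Exports.
Local Open Scope classical_set_scope.
Local Open Scope ring_scope.

Set Implicit Arguments.
Unset Strict Implicit.

(* The canonical measure on [pushforward m f] depends on a proof that [f] is
   measurable, which unification cannot find. *)
Definition pushforward_measure d1 d2 (T1 : measurableType d1)
    (T2 : measurableType d2) (R : realType) (m : {measure set T1 -> \bar R})
    (f : T1 -> T2) (mf : measurable_fun setT f) : {measure set T2 -> \bar R} :=
  measure_function_pushforward__canonical__measure_function_Measure m mf.

(** * Measures given by a density *)

Section measure_density.
Local Open Scope ereal_scope.
Context d (T : measurableType d) (R : realType).
Variables (mu : {measure set T -> \bar R}) (g : T -> R).
Hypotheses (mg : measurable_fun setT g) (g0 : forall x, (0 <= g x)%R).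

Definition mdensity (A : set T) : \bar R := \int[mu]_(x in A) (g x)%:E.

Let mEg (D : set T) : measurable_fun D (fun x => (g x)%:E).
Proof. exact/measurable_EFinP/measurable_funTS. Qed.

Let mdensity0 : mdensity set0 = 0.
Proof. by rewrite /mdensity integral_set0. Qed.

Let mdensity_ge0 A : 0 <= mdensity A.
Proof. by apply: integral_ge0 => x _; rewrite lee_fin. Qed.

Let mdensity_sigma_additive : semi_sigma_additive mdensity.
Proof.
move=> A mA tA mUA; rewrite /mdensity ge0_integral_bigcup//; last first.
  by move=> x _; rewrite lee_fin.
by apply: is_cvg_ereal_nneg_natsum_cond => n _ _; exact: mdensity_ge0.
Qed.

HB.instance Definition _ := isMeasure.Build _ _ _
  mdensity mdensity0 mdensity_ge0 mdensity_sigma_additive.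

Definition mdensity_measure : {measure set T -> \bar R} := mdensity.

Import HBNNSimple.

(** Monotone convergence along simple functions increasing to [f] reduces the claim to a simple
    function. There both sides are the finite sum, over its values, of the value times the
    [mdensity] of its level set. *)
Lemma ge0_integral_mdensity (f : T -> \bar R) :
  measurable_fun setT f -> (forall x, 0 <= f x) ->
  \int[mdensity]_x f x = \int[mu]_x (f x * (g x)%:E).
Proof.
move=> mf f0.
pose h := nnsfun_approx measurableT mf.
have hf x : (h n x)%:E @[n --> \oo] --> f x by exact: cvg_nnsfun_approx.
have nd_h x : {homo (fun n => h n x) : m n / (m <= n)%N >-> (m <= n)%R}.
  by move=> m n mn; exact/lefP/nd_nnsfun_approx.
transitivity (limn (fun n => \int[mdensity]_x (h n x)%:E)).
  rewrite -monotone_convergence//.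
  - by apply: eq_integral => x _; exact/esym/cvg_lim.
  - by move=> n; exact/measurable_EFinP/measurable_funP.
  - by move=> n x _; rewrite lee_fin.
  - by move=> x _ m n mn; rewrite lee_fin nd_h.
transitivity (limn (fun n => \int[mu]_x ((h n x)%:E * (g x)%:E))); last first.
  rewrite -monotone_convergence//.
  - apply: eq_integral => x _; apply/cvg_lim => //.
    by apply: cvgeZr => //; exact: hf.
  - by move=> n; apply: emeasurable_funM => //; exact/measurable_EFinP/measurable_funP.
  - by move=> n x _; rewrite mule_ge0 ?lee_fin.
  - by move=> x _ m n mn; rewrite lee_wpmul2r ?lee_fin// nd_h.
congr (limn _); apply/funext => n.
transitivity (\sum_(k \in range (h n)) k%:E * mdensity (h n @^-1` [set k])).
  under eq_integral do rewrite fimfunE -fsumEFin//.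
  rewrite ge0_integral_fsum//; last 2 first.
  - by move=> y; exact/measurable_EFinP/measurable_funM.
  - by move=> y x _; rewrite nnfun_muleindic_ge0.
  apply: eq_fsbigr => r _; rewrite integralZl_indic_nnsfun// integral_indic//=.
  by rewrite setIT.
transitivity (\int[mu]_x (\sum_(k \in range (h n))
    (k * \1_(h n @^-1` [set k]) x)%:E * (g x)%:E)); last first.
  apply: eq_integral => x _; rewrite -ge0_mule_fsuml => [|y]; last exact: nnfun_muleindic_ge0.
  by rewrite fsumEFin// -fimfunE.
rewrite ge0_integral_fsum//; last 2 first.
- move=> y; apply: emeasurable_funM => //.
  exact/measurable_EFinP/measurable_funM.
- by move=> y x _; apply: mule_ge0; [exact: nnfun_muleindic_ge0|rewrite lee_fin].
(* Writing the value as [h n t] makes its nonnegativity available. *)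
apply: eq_fsbigr => r /[!inE] -[t _ <-].
under eq_integral do rewrite EFinM -muleA.
rewrite ge0_integralZl//.
- rewrite /mdensity integral_mkcond epatch_indic.
  by congr (_ * _); apply: eq_integral => x _ /=; rewrite muleC.
- apply: emeasurable_funM => //; exact/measurable_EFinP.
- by move=> x _; rewrite mule_ge0 ?lee_fin.
- by rewrite lee_fin.
Qed.

End measure_density.

(** * Sigma-finiteness of product measures *)

Section sigma_finite_pack.
Context d (T : measurableType d) (R : realType).
Variables (m : {measure set T -> \bar R}) (sfm : sigma_finite setT m).

(** An alias of [m]: structure instances attach to a head constant, which the variable [m] is
    not. *)
Definition sigma_finite_copy : set T -> \bar R := m.

HB.instance Definition _ := Measure.on sigma_finite_copy.

HB.instance Definition _ :=
  Measure_isSigmaFinite.Build _ _ _ sigma_finite_copy sfm.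

Definition sigma_finite_pack : {sigma_finite_measure set T -> \bar R} :=
  sigma_finite_copy.

End sigma_finite_pack.

Section sigma_finite_product.
Local Open Scope ereal_scope.
Context d1 d2 (T1 : measurableType d1) (T2 : measurableType d2) (R : realType).
Variables (m1 : {sigma_finite_measure set T1 -> \bar R})
  (m2 : {sigma_finite_measure set T2 -> \bar R}).

Let sigma_finite_product : sigma_finite setT (m1 \x m2).
Proof.
have /sigma_finiteP[F [TF ndF mF]] := sigma_finiteT m1.
have /sigma_finiteP[G [TG ndG mG]] := sigma_finiteT m2.
exists (fun n => F n `*` G n) => [|n].
  apply/seteqP; split => // -[x y] _.
  have [n _ Fn] : (\bigcup_n F n) x by rewrite -TF.
  have [k _ Gk] : (\bigcup_n G n) y by rewrite -TG.
  (* Both exhaustions increase, so the two coordinates can be caught at one common index. *)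
  exists (maxn n k) => //; split.
  - exact: (subsetPset _ _ (ndF _ _ (leq_maxl n k))).
  - exact: (subsetPset _ _ (ndG _ _ (leq_maxr n k))).
have [mFn Fn] := mF n; have [mGn Gn] := mG n.
split; first exact: measurableX.
by rewrite product_measure1E// lte_mul_pinfty// ge0_fin_numE.
Qed.

(* Unification finds the library instance only on products of subprobabilities. *)
Definition sigma_finite_prod : {sigma_finite_measure set (T1 * T2)%type -> \bar R} :=
  sigma_finite_pack sigma_finite_product.

End sigma_finite_product.

(** * Tonelli's theorem in three variables *)

Section tonelli3.
Local Open Scope ereal_scope.
Context d1 d2 d3 (T1 : measurableType d1) (T2 : measurableType d2)
  (T3 : measurableType d3) (R : realType).
Variables (m1 : {sigma_finite_measure set T1 -> \bar R})
  (m2 : {sigma_finite_measure set T2 -> \bar R})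
  (m3 : {sigma_finite_measure set T3 -> \bar R}).
Variable f : T1 * T2 * T3 -> \bar R.
Hypotheses (mf : measurable_fun setT f) (f0 : forall x, 0 <= f x).

Lemma measurable_integral3 :
  measurable_fun setT (fun w : T1 * T2 => \int[m3]_z f (w, z)).
Proof. exact: (@measurable_fun_fubini_tonelli_F _ _ _ _ _ m3 f mf f0). Qed.

Lemma measurable_integral23 :
  measurable_fun setT (fun x : T1 => \int[m2]_y \int[m3]_z f (x, y, z)).
Proof.
apply: (@measurable_fun_fubini_tonelli_F _ _ _ _ _ m2
  (fun w : T1 * T2 => \int[m3]_z f (w, z))) => [|w].
  exact: measurable_integral3.
by apply: integral_ge0.
Qed.

(** This and the next two lemmas put each coordinate outermost in turn, as the marginal of that
    coordinate requires. *)
Lemma tonelli123 : \int[m1 \x m2 \x m3]_x f x =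
  \int[m1]_x \int[m2]_y \int[m3]_z f (x, y, z).
Proof.
transitivity (\int[m1 \x m2]_w \int[m3]_z f (w, z)).
  exact: (fubini_tonelli1 (m1 := sigma_finite_prod m1 m2) (m2 := m3) f mf f0).
apply: (fubini_tonelli1 (fun w : T1 * T2 => \int[m3]_z f (w, z))) => [|w].
  exact: measurable_integral3.
by apply: integral_ge0.
Qed.

Lemma tonelli213 : \int[m1 \x m2 \x m3]_x f x =
  \int[m2]_y \int[m1]_x \int[m3]_z f (x, y, z).
Proof.
rewrite tonelli123.
apply: (fubini_tonelli (fun w : T1 * T2 => \int[m3]_z f (w, z))) => [|w].
  exact: measurable_integral3.
by apply: integral_ge0.
Qed.

Lemma tonelli312 : \int[m1 \x m2 \x m3]_x f x =
  \int[m3]_z \int[m1]_x \int[m2]_y f (x, y, z).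
Proof.
transitivity (\int[m3]_z \int[m1 \x m2]_w f (w, z)).
  exact: (fubini_tonelli2 (m1 := sigma_finite_prod m1 m2) (m2 := m3) f mf f0).
apply: eq_integral => z _.
apply: (fubini_tonelli1 (fun w : T1 * T2 => f (w, z))) => [|w]; last exact: f0.
exact: (measurableT_comp mf (pair2_measurable z)).
Qed.

End tonelli3.

(** * Dilations and Lebesgue measure in dimensions one to three *)

Section lebesgue_scaling.
Local Open Scope ereal_scope.
Context {R : realType}.
Local Notation leb := (@lebesgue_measure R).
Local Notation leb3 := ((leb \x leb) \x leb).

(** Lebesgue measure is determined by its values on the intervals []a, b]], and the preimage []a /
    c, b / c]] of such an interval has length [(b - a) / c]. *)
Lemma lebesgue_measure_scale (c : R) (A : set R) : (0 < c)%R -> measurable A ->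
  c%:E * pushforward leb ( *%R c : R -> measurableTypeR R) A = leb A.
Proof.
move=> c0 mA.
have mc : measurable_fun setT ( *%R c : measurableTypeR R -> measurableTypeR R).
  exact: measurable_funM.
pose push := pushforward_measure leb mc.
apply/esym/(lebesgue_measure_unique (mu := mscale (NngNum (ltW c0)) push)) => //.
move=> _ [[a b]] _ <-.
rewrite -[RHS]/(c%:E * leb (( *%R c) @^-1` `]a, b]%classic)).
rewrite (_ : _ @^-1` _ = `](a / c)%R, (b / c)%R]%classic); last first.
  apply/seteqP; split => x /=; rewrite !in_itv/=;
    by rewrite ltr_pdivrMr// ler_pdivlMr// ![(x * c)%R]mulrC.
rewrite !lebesgue_measure_itv/= !lte_fin ltr_pM2r ?invr_gt0//.
case: ifP => _; last by rewrite mule0.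
by rewrite -!EFinD -EFinM -mulrBl mulrC divfK// gt_eqF.
Qed.

Lemma ge0_integral_scale (c : R) (f : R -> \bar R) : (0 < c)%R ->
  measurable_fun setT f -> (forall x, 0 <= f x) ->
  \int[leb]_x f x = c%:E * \int[leb]_x f (c * x)%R.
Proof.
move=> c0 mf f0.
have mc : measurable_fun setT ( *%R c : R -> measurableTypeR R).
  exact: measurable_funM.
pose push := pushforward_measure leb mc.
rewrite (eq_measure_integral (mscale (NngNum (ltW c0)) push)) => [|A mA _]; last first.
  exact/esym/(lebesgue_measure_scale c0 mA).
rewrite ge0_integral_mscale//; congr (_ * _).
by rewrite ge0_integral_pushforward.
Qed.

Lemma ge0_integral_scale2 (c : R) (f : R * R -> \bar R) : (0 < c)%R ->
  measurable_fun setT f -> (forall x, 0 <= f x) ->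
  \int[leb]_x \int[leb]_y f (x, y) =
    (c ^+ 2)%:E * \int[leb]_x \int[leb]_y f (c * x, c * y)%R.
Proof.
move=> c0 mf f0.
have c0E : 0 <= c%:E by rewrite lee_fin ltW.
have mfx x : measurable_fun setT (fun y : R => f (x, y)).
  exact: (measurableT_comp mf (pair1_measurable _)).
have mcf : measurable_fun setT (fun x : R => \int[leb]_y f (c * x, c * y)%R).
  pose g (w : R * R) := f (c * w.1, c * w.2)%R.
  apply: (@measurable_fun_fubini_tonelli_F _ _ _ _ _ leb g) => [|w]; last exact: f0.
  apply: (measurableT_comp mf); apply: measurable_fun_pair; exact: measurable_funM.
rewrite (ge0_integral_scale c0); last 2 first.
- exact: (@measurable_fun_fubini_tonelli_F _ _ _ _ _ leb f mf f0).
- by move=> x; apply: integral_ge0.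
under eq_integral => x _ do rewrite (ge0_integral_scale c0 (mfx _))//.
rewrite ge0_integralZl//; last by move=> x _; apply: integral_ge0.
by rewrite muleA -EFinM.
Qed.

(** Tonelli splits off the first coordinate, which contributes a factor [c]; the other two
    contribute [c ^+ 2]. *)
Lemma ge0_integral_scale3 (c : R) (f : vec3 R -> \bar R) : (0 < c)%R ->
  measurable_fun setT f -> (forall x, 0 <= f x) ->
  \int[leb3]_x f x =
    (c ^+ 3)%:E * \int[leb3]_x f (c * x.1.1, c * x.1.2, c * x.2)%R.
Proof.
move=> c0 mf f0.
pose g (x : vec3 R) := f (c * x.1.1, c * x.1.2, c * x.2)%R.
have mg : measurable_fun setT g.
  apply: (measurableT_comp mf).
  apply: measurable_fun_pair; last by apply: measurable_funM.
  apply: measurable_fun_pair; apply: measurable_funM => //.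
    exact: measurableT_comp.
  exact: (measurableT_comp measurable_snd).
have mfx x : measurable_fun setT (fun w : R * R => f (x, w.1, w.2)).
  apply: (measurableT_comp mf); apply: measurable_fun_pair => //.
  by apply: measurable_fun_pair.
rewrite (tonelli123 leb leb leb mf f0).
rewrite -/(g _) (tonelli123 leb leb leb mg (fun=> f0 _)).
rewrite (ge0_integral_scale c0); last 2 first.
- exact: measurable_integral23.
- by move=> x; apply: integral_ge0 => y _; apply: integral_ge0.
under eq_integral => x _ do
  rewrite (ge0_integral_scale2 (f := fun w => f (_, w.1, w.2)) c0 (mfx _))//=.
rewrite ge0_integralZl//; last 3 first.
- exact: (measurable_integral23 leb leb mg (fun=> f0 _)).
- by move=> x _; apply: integral_ge0 => y _; apply: integral_ge0.
- by rewrite lee_fin exprn_ge0// ltW.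
by rewrite muleA -EFinM -exprS.
Qed.

End lebesgue_scaling.

(** * Hyperbolic functions and the radial density *)

Section hyperbolic_functions.
Context {R : realType}.
Implicit Types s t y : R.

Lemma is_derive_sinh s : is_derive s 1 (@sinh R) (cosh s).
Proof.
have dN : is_derive s 1 (fun x : R => expR (- x)) (- expR (- s)).
  by apply: is_derive_eq; rewrite /GRing.scale/=; ring.
rewrite /sinh /cosh; apply: is_derive_eq.
by rewrite /GRing.scale/=; field.
Qed.

Lemma continuous_sinh : continuous (@sinh R).
Proof.
by move=> s; apply/differentiable_continuous/derivable1_diffP; case: (is_derive_sinh s).
Qed.

Lemma continuous_cosh : continuous (@cosh R).
Proof.
move=> s; apply: cvgM; last exact: cvg_cst.
apply: cvgD; first exact: continuous_expR.
by apply: continuous_comp; [exact: opp_continuous|exact: continuous_expR].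
Qed.

Lemma cosh_gt0 s : 0 < cosh s.
Proof. by rewrite divr_gt0// addr_gt0// expR_gt0. Qed.

Lemma sinh0 : sinh 0 = 0 :> R.
Proof. by rewrite /sinh oppr0 subrr mul0r. Qed.

Lemma ler_sinh : {mono @sinh R : s t / s <= t}.
Proof.
apply: le_mono => s t st; rewrite /sinh ltr_pM2r// ltrD// ?ltrN2 ltr_expR//.
by rewrite ltrN2.
Qed.

Lemma cosh2 s : cosh s ^+ 2 = 1 + sinh s ^+ 2.
Proof.
have : expR s * expR (- s) = 1 by rewrite expRN divff// gt_eqF ?expR_gt0.
rewrite /cosh /sinh; move: (expR s) (expR (- s)) => a b ab.
by transitivity (a * b + ((a - b) / 2) ^+ 2); [field|rewrite ab].
Qed.

Definition asinh y : R := ln (y + Num.sqrt (y ^+ 2 + 1)).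

Lemma asinhK : cancel asinh (@sinh R).
Proof.
move=> y; rewrite /sinh /asinh.
have w0 : 0 <= y ^+ 2 + 1 by rewrite addr_ge0 ?sqr_ge0.
have a0 : 0 < y + Num.sqrt (y ^+ 2 + 1).
  rewrite -ltrBlDl sub0r (le_lt_trans (ler_norm _))// normrN -sqrtr_sqr.
  by rewrite ltr_sqrt ?ltrDl// (lt_le_trans ltr01)// lerDr sqr_ge0.
rewrite expRN lnK ?posrE//.
have := sqr_sqrtr w0; move: (Num.sqrt _) a0 => w a0 w2.
(* As [w ^+ 2 - y ^+ 2 = 1], the factors [w + y] and [w - y] are the exponentials of [asinh y] and
   [- asinh y]. *)
have -> : (y + w)^-1 = w - y.
  apply: (mulfI (lt0r_neq0 a0)); rewrite divff ?lt0r_neq0//.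
  by transitivity (w ^+ 2 - y ^+ 2); [rewrite w2|]; ring.
by field.
Qed.

Lemma measurable_asinh : measurable_fun setT asinh.
Proof.
apply: measurableT_comp; first exact: measurable_ln.
apply: measurable_funD => //.
apply: (measurableT_comp (f := @Num.sqrt R)); last by apply: measurable_funD.
by apply: continuous_measurable_fun; exact: sqrt_continuous.
Qed.

(** The factor [r ^+ 2 dr] of polar coordinates in dimension three, written with [r = sinh s] and
    extended by zero to the whole line. *)
Definition radial_density s : R := if 0 < s then sinh s ^+ 2 * cosh s else 0.

Lemma radial_density_ge0 s : 0 <= radial_density s.
Proof.
by rewrite /radial_density; case: ifP => // _; rewrite mulr_ge0 ?sqr_ge0// ltW// cosh_gt0.
Qed.

Lemma measurable_radial_density : measurable_fun setT radial_density.
Proof.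
apply: measurable_fun_ifT => //; first by apply: measurable_fun_ltr.
apply: measurable_funM; last exact: (continuous_measurable_fun continuous_cosh).
by apply: measurable_funX; exact: (continuous_measurable_fun continuous_sinh).
Qed.

(** An antiderivative is [sinh s ^+ 3 / 3], which vanishes at 0; [Num.max b 0] covers the rays on
    which the density is zero. *)
Lemma integral_radial_density b :
  (\int[lebesgue_measure]_(s in `]-oo, b]) (radial_density s)%:E =
   (sinh (Num.max b 0) ^+ 3 / 3)%:E)%E.
Proof.
have [b0|b0] := leP b 0.
  rewrite sinh0 expr0n mul0r; apply: integral0_eq => s /=.
  by rewrite in_itv/= => sb; rewrite /radial_density ltNge (le_trans sb b0).
transitivity (\int[lebesgue_measure]_(s in `]0%R, b])
    (sinh s ^+ 2 * cosh s)%:E)%E.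
  rewrite integral_mkcond [RHS]integral_mkcond; apply: eq_integral => s _.
  rewrite !patchE !mem_setE !in_itv/= /radial_density.
  by case: ltP => //=; case: ifP.
(* The endpoint 0 is added because the fundamental theorem of calculus is applied on a closed
   interval. *)
rewrite integral_itv_obnd_cbnd; last first.
  apply/measurable_EFinP/measurable_funTS/measurable_funM.
    by apply: measurable_funX; exact: (continuous_measurable_fun continuous_sinh).
  exact: (continuous_measurable_fun continuous_cosh).
have dF s : is_derive s 1 (fun s => sinh s ^+ 3 / 3) (sinh s ^+ 2 * cosh s).
  have ds := is_derive_sinh s.
  by apply: is_derive_eq; rewrite /GRing.scale/=; field.
have cF : continuous (fun s => sinh s ^+ 3 / 3).
  by move=> s; apply/differentiable_continuous/derivable1_diffP; case: (dF s).
rewrite (continuous_FTC2 (F := fun s => sinh s ^+ 3 / 3))//.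
- by rewrite sinh0 expr0n mul0r sube0.
- apply: continuous_subspaceT => s; apply: cvgM; last exact: continuous_cosh.
  apply: (cvg_comp (@sinh R) (fun x => x ^+ 2)); first exact: continuous_sinh.
  exact: exprn_continuous.
- split; first by move=> s _; case: (dF s).
  + exact/cvg_at_right_filter/cF.
  + exact/cvg_at_left_filter/cF.
- by move=> s _; rewrite derive1E; apply: derive_val.
Qed.

End hyperbolic_functions.

(** * Measures on the line determined by their values on rays *)

Section ray_uniqueness.
Local Open Scope ereal_scope.
Context {R : realType}.

Lemma bigcup_itvNyc_natr : \bigcup_n `]-oo, n%:R]%classic = [set: R].
Proof.
apply/seteqP; split => // x _; exists (Num.truncn x).+1 => //=.
by rewrite in_itv/= ltW// truncnS_gt.
Qed.

(** The closed left rays are stable under intersection, generate the Borel sets because their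
    complements are the open right rays, and exhaust the line along the natural numbers. *)
Lemma measure_unique_rays (m1 m2 : {measure set (measurableTypeR R) -> \bar R}) :
  (forall b, m1 `]-oo, b]%classic = m2 `]-oo, b]%classic) ->
  (forall b, m1 `]-oo, b]%classic < +oo) ->
  forall A, measurable A -> m1 A = m2 A.
Proof.
move=> m12 m1oo A mA.
pose G := [set A : set (measurableTypeR R) | exists x : R, A = `]-oo, x]%classic].
apply: (@measure_unique _ _ _ G (fun n => `]-oo, n%:R]%classic) _ _ _ _ m1 m2) => //.
- rewrite [LHS]RGenOInfty.measurableE eqEsubset; split => B.
    apply: smallest_sub; first exact: smallest_sigma_algebra.
    move=> _ [x ->]; rewrite -setCitvl.
    by apply: (@measurableC _ (g_sigma_algebraType G)); apply: sub_sigma_algebra; exists x.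
  apply: smallest_sub; first exact: smallest_sigma_algebra.
  by move=> _ [x ->]; rewrite -RGenOInfty.measurableE; exact: measurable_itv.
- move=> _ _ [x ->] [y ->]; exists (Num.min x y).
  by apply/seteqP; split => z /=; rewrite !in_itv/= le_min => /andP.
- by move=> n; exists n%:R.
- exact: bigcup_itvNyc_natr.
- by move=> _ [x ->].
Qed.

End ray_uniqueness.

(** * Euclidean norm and radial projection *)

Section euclidean_norm.
Context {R : realType}.

Lemma component_scale (c : R) x i :
  component i (c * x.1.1, c * x.1.2, c * x.2)%R = (c * component i x)%R.
Proof. by rewrite /component/=; case: i => -[|[|[|]]]. Qed.

Lemma enorm_ge0 (x : vec3 R) : (0 <= enorm x)%R. Proof. exact: sqrtr_ge0. Qed.

Lemma enorm_sqr x :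
  enorm x ^+ 2 = x.1.1 ^+ 2 + (x.1.2 ^+ 2 + x.2 ^+ 2) :> R.
Proof.
rewrite sqr_sqrtr; last by apply: sumr_ge0 => i _; exact: sqr_ge0.
by rewrite !big_ord_recl big_ord0 addr0.
Qed.

Lemma enorm_scale (c : R) (x : vec3 R) : (0 <= c)%R ->
  enorm (c * x.1.1, c * x.1.2, c * x.2)%R = (c * enorm x)%R.
Proof.
move=> c0; rewrite /enorm; under eq_bigr do rewrite component_scale exprMn.
by rewrite -mulr_sumr sqrtrM ?sqr_ge0// sqrtr_sqr ger0_norm.
Qed.

Lemma enorm_eq0 (x : vec3 R) : (enorm x == 0)%R = (x == 0).
Proof.
rewrite /enorm sqrtr_eq0 le_eqVlt [X in _ || X]ltNge sumr_ge0 ?orbF => [|i _]; last first.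
  exact: sqr_ge0.
rewrite psumr_eq0 => [|i _]; last exact: sqr_ge0.
apply/idP/idP => [/allP x0|/eqP ->].
  have c0 i : component i x = 0%R.
    by have := x0 i (mem_index_enum _); rewrite sqrf_eq0 => /eqP.
  case: x c0 {x0} => -[a b] c c0.
  have := c0 (@Ordinal 3 0 isT); have := c0 (@Ordinal 3 1 isT); have := c0 (@Ordinal 3 2 isT).
  by rewrite /component/= => -> -> ->.
by apply/allP => -[[|[|[|]]]//= ?] _; rewrite /component/= expr0n.
Qed.

Lemma enorm_gt0 (x : vec3 R) : (0 < enorm x)%R = (x != 0).
Proof. by rewrite lt0r enorm_ge0 andbT enorm_eq0. Qed.

Lemma normalise_scale (c : R) (x : vec3 R) : (0 < c)%R ->
  normalise (c * x.1.1, c * x.1.2, c * x.2)%R = normalise x.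
Proof.
move=> c0; have cK a : c * a / (c * enorm x) = a / enorm x.
  by rewrite invfM mulrACA divff ?mul1r// gt_eqF.
by rewrite /normalise enorm_scale ?ltW//= !cK.
Qed.

Lemma normalise_sphere (x : vec3 R) : x != 0 -> sphere (normalise x).
Proof.
rewrite -enorm_gt0 => x0; rewrite /sphere/= /normalise.
rewrite ![(_ / enorm x)%R]mulrC enorm_scale ?invr_ge0 ?enorm_ge0//.
by rewrite mulVf ?gt_eqF.
Qed.

End euclidean_norm.

(** * Polar coordinates in dimension three *)

Section polar_coordinates.
Local Open Scope ereal_scope.
Context {R : realType}.

Local Notation leb := (@lebesgue_measure R).
Local Notation leb3 := ((leb \x leb) \x leb).

(** Off the origin, this inverts [(s, y) |-> sinh s * y] for [s > 0] and [y] on the sphere. At the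
    origin, division by zero makes the second entry the zero vector, which is not on the sphere. *)
Definition polar (x : vec3 R) : R * vec3 R := (asinh (enorm x), normalise x).

Lemma measurable_polar : measurable_fun setT polar.
Proof.
apply: measurable_fun_pair; last exact: measurable_normalise.
exact: (measurableT_comp measurable_asinh measurable_enorm).
Qed.

Lemma set0_vec3 : [set 0%R : vec3 R] = ([set 0%R] `*` [set 0%R]) `*` [set 0%R].
Proof. by apply/seteqP; split => [_ ->//|[[a b] c] /= [[/= -> ->] ->]]. Qed.

Lemma lebesgue3_set1 : leb3 [set 0%R] = 0.
Proof.
rewrite set0_vec3 product_measure1E//; last by apply: measurableX.
by rewrite [X in _ * X](lebesgue_measure_set1 0%R) mule0.
Qed.

Definition cone (A : set (vec3 R)) (c : R) : set (vec3 R) :=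
  [set x | (0 < enorm x <= c)%R /\ A (normalise x)].

Lemma measurable_cone A c : measurable A -> measurable (cone A c).
Proof.
move=> mA.
have -> : cone A c = (setT `&` enorm @^-1` `]0%R, c]) `&` (setT `&` normalise @^-1` A).
  by rewrite !setTI; apply/seteqP; split => x /=; rewrite in_itv.
apply: measurableI; first exact: measurable_enorm.
exact: measurable_normalise.
Qed.

(** Dilation by [c] carries the cone of radius 1 to the cone of radius [c] and multiplies volume by
    [c ^+ 3]; the division by 3 undoes the factor 3 in [surface_measure]. *)
Lemma lebesgue3_cone A c : measurable A -> (0 <= c)%R ->
  leb3 (cone A c) = (c ^+ 3 / 3)%:E * surface_measure A.
Proof.
move=> mA; rewrite le_eqVlt => /predU1P[<-|c0].
  rewrite expr0n mul0r mul0e (_ : cone A 0 = set0) ?measure0//.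
  by apply/seteqP; split => x //= [/andP[/lt_le_trans h /h]]; rewrite ltxx.
have mC := measurable_cone c mA.
transitivity (\int[leb3]_x (\1_(cone A c) x)%:E).
  by rewrite integral_indic// setIT.
rewrite (ge0_integral_scale3 c0); last 2 first.
- exact/measurable_EFinP/measurable_indic.
- by move=> x; rewrite lee_fin.
rewrite /surface_measure muleA -EFinM divfK//; congr (_ * _).
transitivity (\int[leb3]_x (\1_(cone A 1) x)%:E).
  apply: eq_integral => x _; rewrite !indicE; congr (_%:R)%:E; congr nat_of_bool.
  rewrite /cone; apply/idP/idP; rewrite !inE/= (enorm_scale _ (ltW c0)) (normalise_scale _ c0);
    by rewrite pmulr_rgt0// ger_pMr.
rewrite integral_indic ?setIT//; last exact: measurable_cone.
(* For nonzero [x] the direction lies on the sphere, so this cone is the one that defines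
   [surface_measure]. *)
congr (leb3 _); apply/seteqP; split => x /= [/[dup] x01 /andP[x0 _]].
  by move=> Ax; split => //; split => //; apply: normalise_sphere; rewrite -enorm_gt0.
by move=> [].
Qed.

Let radial_mdensity :=
  mdensity_measure leb measurable_radial_density radial_density_ge0.

Let radial_mdensity_sigma_finite : sigma_finite setT radial_mdensity.
Proof.
exists (fun n => `]-oo, n%:R]%classic); first by rewrite bigcup_itvNyc_natr.
move=> n; split; first exact: measurable_itv.
by rewrite [radial_mdensity _]integral_radial_density ltry.
Qed.

Definition radial_measure : {sigma_finite_measure set (measurableTypeR R) -> \bar R} :=
  sigma_finite_pack radial_mdensity_sigma_finite.

Lemma radial_measure_ray b :
  radial_measure `]-oo, b]%classic = (sinh (Num.max b 0) ^+ 3 / 3)%:E.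
Proof. exact: integral_radial_density. Qed.

(** Up to the origin, the preimage is the cone over [B] of radius [sinh (Num.max b 0)]. *)
Lemma lebesgue3_polar_ray b B : measurable B ->
  leb3 (polar @^-1` (`]-oo, b]%classic `*` B)) =
  radial_measure `]-oo, b]%classic * surface_measure B.
Proof.
move=> mB; have mS : measurable (polar @^-1` (`]-oo, b]%classic `*` B)).
  rewrite -[X in measurable X]setTI; apply: measurable_polar => //.
  by apply: measurableX => //; exact: measurable_itv.
have m0 : measurable [set 0%R : vec3 R].
  by rewrite set0_vec3; apply: measurableX => //; exact: measurableX.
have b0 : (0 <= sinh (Num.max b 0) :> R)%R.
  by rewrite -[leLHS](@sinh0 R) ler_sinh le_max lexx orbT.
set S := polar @^-1` _ in mS *.
(* The preimage may contain the origin, which cones leave out; it is removed as a null set. *)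
have -> : leb3 S = leb3 (S `\` [set 0%R]) + leb3 (S `&` [set 0%R]) by exact: measureDI.
have -> : leb3 (S `&` [set 0%R]) = 0.
  apply/eqP; rewrite eq_le measure_ge0 andbT -lebesgue3_set1.
  by apply: le_measure; rewrite ?inE//; exact: measurableI.
rewrite adde0 radial_measure_ray -lebesgue3_cone//; congr (leb3 _).
have asinh_le r : (asinh r <= b)%R = (r <= sinh b)%R by rewrite -ler_sinh asinhK.
rewrite /S; apply/seteqP; split => x /=; rewrite in_itv/= asinh_le.
  move=> [[xb Bx] /eqP]; rewrite -enorm_gt0 => x0; split => //; rewrite x0/=.
  by rewrite (le_trans xb)// ler_sinh le_max lexx.
move=> [/andP[x0 xb] Bx]; split; last by apply/eqP; rewrite -enorm_gt0.
split => //; move: xb; have [_|_//] := leP b 0%R; rewrite ?sinh0 => /(lt_le_trans x0).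
by rewrite ltxx.
Qed.

(** For fixed [B] both sides are measures in [A] that agree, with finite values, on rays. *)
Lemma lebesgue3_polar_rectangle A B : measurable A -> measurable B ->
  leb3 (polar @^-1` (A `*` B)) = radial_measure A * surface_measure B.
Proof.
move=> mA mB.
have sB : surface_measure B \is a fin_num by exact: fin_num_measure.
have mD : measurable (normalise @^-1` B).
  by rewrite -[X in measurable X]setTI; exact: measurable_normalise.
have mg : measurable_fun setT (fun x : vec3 R => asinh (enorm x) : measurableTypeR R).
  exact: (measurableT_comp measurable_asinh measurable_enorm).
(* [mscale] takes a nonnegative real; [fine] loses nothing because the surface measure is finite. *)
pose m1 := mscale (NngNum (fine_ge0 (measure_ge0 surface_measure B))) radial_measure.
pose m2 := pushforward_measure (mrestr leb3 mD) mg.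
have m1E X : m1 X = radial_measure X * surface_measure B.
  by rewrite muleC /m1 /mscale/= fineK.
rewrite -m1E -[LHS]/(m2 A); apply/esym/(measure_unique_rays (m1 := m1) (m2 := m2)) => //.
  by move=> b; exact: etrans (m1E _) (esym (lebesgue3_polar_ray b mB)).
by move=> b; rewrite [X in X < _]m1E radial_measure_ray ltey_eq fin_numM.
Qed.

(** Agreement on rectangles identifies the image of Lebesgue measure under [polar] with the product
    of the radial and surface measures. *)
Lemma polar_integral (f : R * vec3 R -> \bar R) :
  measurable_fun setT f -> (forall z, 0 <= f z) ->
  \int[leb3]_x f (polar x) =
  \int[leb \x surface_measure]_z (f z * (radial_density z.1)%:E).
Proof.
move=> mf f0.
pose T1 : measurableType _ :=
  ((measurableTypeR R * measurableTypeR R) * measurableTypeR R)%type.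
pose T2 : measurableType _ := (measurableTypeR R * vec3 R)%type.
have mp : @measurable_fun _ _ T1 T2 setT polar by exact: measurable_polar.
pose m := pushforward_measure leb3 mp.
transitivity (\int[m]_z f z).
  by apply/esym; exact: (ge0_integral_pushforward mp leb3 measurableT mf (fun z _ => f0 z)).
transitivity (\int[radial_measure \x surface_measure]_z f z).
  apply: eq_measure_integral => X mX _; apply/esym.
  apply: (product_measure_unique (m' := m)) => // A B mA mB.
  exact: lebesgue3_polar_rectangle.
(* With the direction outermost, the radial density is extracted from a one-variable integral. *)
rewrite fubini_tonelli2// [RHS]fubini_tonelli2; last 2 first.
- apply: emeasurable_funM => //; apply/measurable_EFinP.
  exact: (measurableT_comp measurable_radial_density).
- by move=> z; rewrite mule_ge0 ?lee_fin ?radial_density_ge0.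
apply: eq_integral => y _; apply: ge0_integral_mdensity => //.
- exact: measurable_radial_density.
- exact: radial_density_ge0.
- exact: (measurableT_comp mf (pair2_measurable y)).
Qed.

End polar_coordinates.

(** * Integrating out two momentum coordinates *)

Section marginal.
Local Open Scope ereal_scope.
Context {R : realType}.
Local Notation leb := (@lebesgue_measure R).
Local Notation leb3 := ((leb \x leb) \x leb).
Variable gamma : R.

Let k : R := (- (gamma + 1) / 2)%R.

(** The constant that remains once two coordinates are integrated out. It is kept in the extended
    reals; its finiteness is deduced later from the total mass of the law. *)
Definition planar_mass : \bar R :=
  \int[leb]_a \int[leb]_b ((1 + (a ^+ 2 + b ^+ 2)) `^ k)%:E.

Lemma integral_plane_scale (t : R) : (0 < t)%R ->
  \int[leb]_a \int[leb]_b ((t + (a ^+ 2 + b ^+ 2)) `^ k)%:E =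
  (t `^ (- (gamma - 1) / 2))%:E * planar_mass.
Proof.
move=> t0; have c0 : (0 < Num.sqrt t)%R by rewrite sqrtr_gt0.
have mq (u : R) : measurable_fun setT
    (fun w : R * R => ((u + (w.1 ^+ 2 + w.2 ^+ 2)) `^ k)%:E).
  apply/measurable_EFinP; apply: (measurableT_comp (measurable_powR _)).
  by apply: measurable_funD => //; apply: measurable_funD; apply: measurable_funX.
have mq2 (u : R) : measurable_fun setT
    (fun a : R => \int[leb]_b ((u + (a ^+ 2 + b ^+ 2)) `^ k)%:E).
  apply: (@measurable_fun_fubini_tonelli_F _ _ _ _ _ leb _ (mq u)) => w.
  by rewrite lee_fin powR_ge0.
rewrite (ge0_integral_scale2 c0 (mq t)); last by move=> w; rewrite lee_fin powR_ge0.
transitivity ((Num.sqrt t ^+ 2)%:E * \int[leb]_a ((t `^ k)%:E *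
    \int[leb]_b ((1 + (a ^+ 2 + b ^+ 2)) `^ k)%:E)).
  congr (_ * _); apply: eq_integral => a _.
  rewrite -ge0_integralZl_EFin//; last 3 first.
  - by move=> b _; rewrite lee_fin powR_ge0.
  - exact: (measurableT_comp (mq 1%R) (pair1_measurable a)).
  - exact: powR_ge0.
  apply: eq_integral => b _; rewrite -EFinM -powRM ?ltW//; last first.
    by rewrite ltr_pwDl// addr_ge0 ?sqr_ge0.
  by congr (_ `^ _)%:E; rewrite /= !exprMn sqr_sqrtr ?ltW//; ring.
rewrite ge0_integralZl_EFin//; last 3 first.
- by move=> a _; apply: integral_ge0 => b _; rewrite lee_fin powR_ge0.
- exact: mq2.
- exact: powR_ge0.
rewrite muleA -EFinM sqr_sqrtr ?ltW// -[X in (X * _)%R](powRr1 (ltW t0)).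
rewrite -powRD; last by rewrite (gt_eqF t0) implybT.
rewrite -/planar_mass; congr (_%:E * _); congr (_ `^ _)%R.
by rewrite /k; field.
Qed.

(** With coordinate [i] outermost and equal to [p], the inner integral is the planar one with
    [t = 1 + p ^+ 2]. *)
Lemma integral_component_marginal (i : 'I_3) (B : set R) : measurable B ->
  \int[leb3]_x (\1_B (component i x) * (1 + enorm x ^+ 2) `^ k)%:E =
  planar_mass * \int[leb]_(p in B) ((1 + p ^+ 2) `^ (- (gamma - 1) / 2))%:E.
Proof.
move=> mB.
pose F (x : vec3 R) := (\1_B (component i x) * (1 + enorm x ^+ 2) `^ k)%:E.
have F0 x : 0 <= F x by rewrite lee_fin mulr_ge0 ?powR_ge0.
have mF : measurable_fun setT F.
  apply/measurable_EFinP/measurable_funM.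
    exact: (measurableT_comp (measurable_indic mB) (measurable_coord i)).
  apply: (measurableT_comp (measurable_powR _)); apply: measurable_funD => //.
  by apply: measurable_funX; exact: measurable_enorm.
have plane p : \int[leb]_a \int[leb]_b
    (\1_B p * (1 + p ^+ 2 + (a ^+ 2 + b ^+ 2)) `^ k)%:E =
    (\1_B p)%:E * ((1 + p ^+ 2) `^ (- (gamma - 1) / 2))%:E * planar_mass.
  have p0 : (0 < 1 + p ^+ 2)%R by rewrite ltr_pwDl// sqr_ge0.
  rewrite -muleA -integral_plane_scale// indicE; case: (p \in B).
    by rewrite mul1e; under eq_integral do under eq_integral do rewrite mul1r.
  rewrite mul0e; under eq_integral do under eq_integral do rewrite mul0r.
  by under eq_integral do rewrite integral0; rewrite integral0.
transitivity (\int[leb]_p \int[leb]_a \int[leb]_b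
    (\1_B p * (1 + p ^+ 2 + (a ^+ 2 + b ^+ 2)) `^ k)%:E).
  rewrite -/F; case: i @F F0 mF => -[|[|[|//]]] i3 F F0 mF.
  - rewrite (tonelli123 leb leb leb mF F0).
    do 3 (apply: eq_integral => ? _); rewrite /F enorm_sqr /component/=.
    by congr (_ * _ `^ _)%:E; ring.
  - rewrite (tonelli213 leb leb leb mF F0).
    do 3 (apply: eq_integral => ? _); rewrite /F enorm_sqr /component/=.
    by congr (_ * _ `^ _)%:E; ring.
  - rewrite (tonelli312 leb leb leb mF F0).
    do 3 (apply: eq_integral => ? _); rewrite /F enorm_sqr /component/=.
    by congr (_ * _ `^ _)%:E; ring.
under eq_integral do rewrite plane muleC.
have mphi : measurable_fun setT (fun p : R => ((1 + p ^+ 2) `^ (- (gamma - 1) / 2))%R).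
  apply: (measurableT_comp (measurable_powR _)).
  by apply: measurable_funD => //; exact: measurable_funX.
rewrite ge0_integralZl//.
- congr (_ * _); rewrite [RHS]integral_mkcond epatch_indic.
  by apply: eq_integral => p _ /=; rewrite muleC.
- by apply: emeasurable_funM; apply/measurable_EFinP; [exact: measurable_indic|exact: mphi].
- by move=> p _; rewrite mule_ge0// lee_fin// powR_ge0.
- by apply: integral_ge0 => a _; apply: integral_ge0 => b _; rewrite lee_fin powR_ge0.
Qed.

Lemma invariant_weight_component (i : 'I_3) (B : set R) : measurable B ->
  invariant_weight gamma [set z | B (sinh z.1 * component i z.2)%R] =
  \int[leb3]_x (\1_B (component i x) * (1 + enorm x ^+ 2) `^ k)%:E.
Proof.
move=> mB.
(* The restriction to [s > 0] is carried by [radial_density], so [E] only records the sphere and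
   [B]. *)
pose E := [set z : R * vec3 R | sphere z.2 /\ B (sinh z.1 * component i z.2)%R].
pose f z := (\1_E z * (1 + sinh z.1 ^+ 2) `^ k)%:E.
have f0 z : 0 <= f z by rewrite lee_fin mulr_ge0 ?powR_ge0.
have msinh : measurable_fun setT (fun z : R * vec3 R => sinh z.1).
  exact: (measurableT_comp (continuous_measurable_fun continuous_sinh)).
have mE : measurable E.
  rewrite (_ : E = (setT `&` (@snd R (vec3 R)) @^-1` sphere) `&`
      (setT `&` (fun z : R * vec3 R => sinh z.1 * component i z.2)%R @^-1` B)).
    apply: measurableI.
      by apply: measurable_snd => //; exact: measurable_sphere.
    apply: (measurable_funM msinh) => //.
    exact: (measurableT_comp (measurable_coord i)).
  by rewrite !setTI.
have mf : measurable_fun setT f.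
  apply/measurable_EFinP/measurable_funM; first exact: measurable_indic.
  apply: (measurableT_comp (measurable_powR _)); apply: measurable_funD => //.
  exact: measurable_funX.
have inE_ray (z : R * vec3 R) :
    (z \in [set z : R * vec3 R | B (sinh z.1 * component i z.2)%R] `&`
      (`]0%R, +oo[%classic `*` sphere)) = (0 < z.1)%R && (z \in E).
  apply/idP/idP; rewrite !inE/= in_itv/= andbT.
    by move=> [By [s0 Sy]]; rewrite s0/= inE; split.
  by move=> /andP[s0]; rewrite inE => -[Sy By]; split.
transitivity (\int[leb \x surface_measure]_z (f z * (radial_density z.1)%:E)).
  rewrite /invariant_weight integral_mkcond; apply: eq_integral => z _.
  rewrite patchE inE_ray /f indicE /radial_density/=.
  case: z => s y /=; case: (ltP 0%R s) => [s0|_] /=; last by rewrite mule0.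
  case: (_ \in E) => /=; last by rewrite mul0r mul0e.
  rewrite mul1r -EFinM -cosh2 -(powR_mulrn 2 (ltW (cosh_gt0 s))) -powRrM.
  (* This is [- gamma = 2 * k + 1]. *)
  have -> : (cosh s `^ (- gamma) = cosh s `^ (2 * k) * cosh s)%R.
    rewrite -[X in (_ * X)%R](powRr1 (ltW (cosh_gt0 s))) -powRD; last first.
      by rewrite (gt_eqF (cosh_gt0 s)) implybT.
    by congr (_ `^ _)%R; rewrite /k; field.
  by congr _%:E; ring.
transitivity (\int[leb3]_x f (polar x)).
  by apply/esym; exact: (polar_integral mf f0).
have mg : measurable_fun setT
    (fun x : vec3 R => (\1_B (component i x) * (1 + enorm x ^+ 2) `^ k)%:E).
  apply/measurable_EFinP/measurable_funM.
    exact: (measurableT_comp (measurable_indic mB) (measurable_coord i)).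
  apply: (measurableT_comp (measurable_powR _)); apply: measurable_funD => //.
  by apply: measurable_funX; exact: measurable_enorm.
apply: ge0_ae_eq_integral.
- exact: measurableT.
- exact: (measurableT_comp mf measurable_polar).
- exact: mg.
- by move=> x _; exact: f0.
- by move=> x _; rewrite lee_fin mulr_ge0 ?powR_ge0.
(* At the origin the indicator of [E] vanishes, since the direction is off the sphere, while [B] may
   contain 0; elsewhere the integrands agree. *)
exists [set 0%R]; split.
- by rewrite set0_vec3; apply: measurableX => //; exact: measurableX.
- exact: lebesgue3_set1.
move=> x /= /not_implyP[_ fx]; apply: contrapT => /eqP x0; apply: fx.
rewrite /f /polar/= asinhK; congr (_ * _)%:E.
rewrite !indicE; congr (_%:R)%R; congr nat_of_bool.
have xi : (enorm x * component i (normalise x))%R = component i x.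
  have ex : enorm x != 0%R by rewrite enorm_eq0.
  rewrite /component /normalise; case: i {E f f0 mE mf mg inE_ray} => -[|[|[|//]]] ? /=;
    by rewrite mulrC divfK.
apply/idP/idP => /set_mem Ex; apply/mem_set.
  by case: Ex => _; rewrite /= asinhK xi.
by split; [exact: normalise_sphere|rewrite /= asinhK xi].
Qed.

End marginal.

(** An infinite factor would make the product infinite, or zero if the other factor is zero. *)
Lemma mule_fin_neq0 (R : realType) (x y : \bar R) (r : R) :
  (0 <= x)%E -> (0 <= y)%E -> r != 0 -> (x * y)%E = r%:E ->
  x = (fine x)%:E /\ y = (fine y)%:E.
Proof.
move: x y => [x||] [y||]// x0 y0 r0.
- move: x0; rewrite lee_fin le_eqVlt => /predU1P[<-|x0]; last by rewrite gt0_muley.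
  by rewrite mul0e => -[r00]; rewrite -r00 eqxx in r0.
- move: y0; rewrite lee_fin le_eqVlt => /predU1P[<-|y0]; last by rewrite gt0_mulye.
  by rewrite mule0 => -[r00]; rewrite -r00 eqxx in r0.
Qed.

(** * Identification of the marginal invariant densities *)

Unset Implicit Arguments.
Set Strict Implicit.

Theorem corollary5p5 (R : realType) (d : measure_display)
    (T : measurableType d) (P : probability T R) (gamma : R)
    (F : R -> set (set T)) (W S : R -> T -> R) (Theta : R -> T -> vec3 R) :
  2 < gamma ->
  filtration F ->
  wiener P F W ->
  radial_diffusion P F gamma W S ->
  wiener_sphere P Theta ->
  independent_processes P S Theta ->
  forall t : R, 0 <= t ->
  has_law P (fun w => (S t w, Theta (clock S t w) w)) (invariant_law gamma) ->
  forall i : 'I_3,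
  has_density P (fun w => momentum S Theta t w ord0 (lift ord0 i))
    (fun p => (n_gamma gamma)^-1 * (1 + p ^+ 2) `^ (- (gamma - 1) / 2)).
Proof.
move=> _ _ _ _ _ _ t _ [mX lawX] i.
pose h (z : R * vec3 R) := sinh z.1 * component i z.2.
pose phi (p : R) := (1 + p ^+ 2) `^ (- (gamma - 1) / 2).
have phi0 p : 0 <= phi p by exact: powR_ge0.
have mh : measurable_fun setT h.
  apply: measurable_funM; last exact: (measurableT_comp (measurable_coord i)).
  exact: (measurableT_comp (continuous_measurable_fun continuous_sinh)).
have mphi : measurable_fun setT phi.
  apply: (measurableT_comp (measurable_powR _)).
  by apply: measurable_funD => //; exact: measurable_funX.
have hE : (fun w => momentum S Theta t w ord0 (lift ord0 i)) =
    h \o (fun w => (S t w, Theta (clock S t w) w)).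
  by apply/funext => w; rewrite /momentum mxE liftK.
have weightE B : measurable B -> invariant_weight gamma (h @^-1` B) =
    (planar_mass gamma * \int[lebesgue_measure]_(p in B) (phi p)%:E)%E.
  move=> mB; rewrite -(integral_component_marginal _ i)//.
  exact: invariant_weight_component.
have weightT : invariant_weight gamma setT =
    (planar_mass gamma * \int[lebesgue_measure]_p (phi p)%:E)%E.
  exact: (weightE setT).
(* The law of a random variable has total mass one. *)
have law1 : ((fine (invariant_weight gamma setT))^-1%:E * invariant_weight gamma setT)%E = 1%E.
  have <- : pushforward P (fun w => (S t w, Theta (clock S t w) w)) setT = 1%E.
    by rewrite /pushforward preimage_setT; exact: probability_setT.
  by rewrite lawX.
have C0 : (0 <= planar_mass gamma)%E.
  by apply: integral_ge0 => a _; apply: integral_ge0 => b _; rewrite lee_fin powR_ge0.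
have I0 : (0 <= \int[lebesgue_measure]_p (phi p)%:E)%E.
  by apply: integral_ge0 => p _; rewrite lee_fin.
have n0 : 0 <= n_gamma gamma by exact: fine_ge0.
(* Since [fine] sends infinities to 0 and the inverse of 0 is 0, an infinite or zero total weight
   would give the law mass 0. *)
have [r r0 weight_r] : exists2 r, r != 0 & invariant_weight gamma setT = r%:E.
  move: law1; case: (invariant_weight gamma setT) => [r||] /=.
  - move=> -[r1]; exists r => //; apply: contra_eq_neq r1 => ->.
    by rewrite mulr0 eq_sym oner_eq0.
  - by rewrite invr0 mul0e => /eqP; rewrite eq_sym onee_eq0.
  - by rewrite invr0 mul0e => /eqP; rewrite eq_sym onee_eq0.
(* Both factors of the total weight are therefore finite, and [n_gamma gamma] is the true value of
   its integral. *)
have [CE IE] := mule_fin_neq0 C0 I0 r0 (etrans (esym weightT) weight_r).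
have rE : r = fine (planar_mass gamma) * n_gamma gamma.
  by apply: EFin_inj; rewrite -weight_r weightT {1}CE {1}IE.
split; first exact: measurable_funM.
  by move=> p; rewrite mulr_ge0 ?invr_ge0 ?powR_ge0.
rewrite hE; split=> [|B mB]; first exact: measurableT_comp.
have mhB : measurable (h @^-1` B) by rewrite -[X in measurable X]setTI; exact: mh.
transitivity (invariant_law gamma (h @^-1` B)); first exact: lawX.
rewrite /invariant_law weightE// weight_r CE muleA -EFinM.
under [RHS]eq_integral do rewrite EFinM.
rewrite ge0_integralZl_EFin ?invr_ge0//.
(* The planar mass occurs in both the weight of [B] and the total weight, and cancels. *)
- congr (_%:E * _)%E; move: r0; rewrite /= rE mulf_eq0 negb_or => /andP[c0 m0].
  by rewrite invfM mulrC mulrA divff// mul1r.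
- by move=> p _; rewrite lee_fin powR_ge0.
- exact/measurable_EFinP/measurable_funTS.
Qed.
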